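(* Assume that the following conditions are fulfilled: (a) $a\in\mathbb{R}^{\ell}$, $F\subseteq\mathbb{R}^{\ell}$ is a nonempty closed set, and there exists some $u\in\mathbb{R}^{\ell}$ with $F\subseteq u+\mathbb{R}^{\ell}_+$. (b) $H$ is a proper closed subset of $\mathbb{R}^{\ell}$ with $\mathbb{R}^{\ell}_+\subseteq 0^+H$ and $k\in\operatorname{core}0^+H$ that, for each $j\in\{1,\ldots,\ell\}$, does not contain any line in the direction $e^j$. Here $k\in 0^+H\setminus\{0\}$. Then $M_{F,a,H,k}$ is nonempty and compact.
   Context: $\ell\ge 1$ is an integer, $\mathbb{R}^{\ell}_+$ is the nonnegative orthant, and $e^j$ is the $j$-th standard unit vector of $\mathbb{R}^{\ell}$. For $A\subseteq\mathbb{R}^{\ell}$, the recession cone is $0^+A:=\{u\in\mathbb{R}^{\ell}\mid A+\mathbb{R}_+u\subseteq A\}$, where $\mathbb{R}_+=[0,\infty)$, and $\operatorname{core}A$ is the algebraic interior of $A$. A proper subset of $\mathbb{R}^{\ell}$ is a nonempty subset different from $\mathbb{R}^{\ell}$. A set $H$ contains a line in direction $v$ if $x+\mathbb{R}v\subseteq H$ for some $x$. $(P_{F,a,H,k})$ is the problem of minimizing $t$ over all pairs $(y,t)\in F\times\mathbb{R}$ with $y\in a-H+tk$ (the feasible solutions). $M_{F,a,H,k}$ is the set of its optimal solutions $y$, i.e. of all $y\in F$ for which there is $t\in\mathbb{R}$ such that $(y,t)$ is feasible and $t\le s$ for every feasible $(z,s)$. *)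

(* Defs.v *)
(* Analysis over an arbitrary realType; R^l is the row-vector space 'rV[R]_l. *)
From HB Require Import structures.
From mathcomp Require Import all_boot all_order all_algebra.
From mathcomp Require Import all_classical all_reals all_analysis.
Set Implicit Arguments.
Unset Strict Implicit.
Unset Printing Implicit Defensive.
Import Order.TTheory GRing.Theory Num.Theory.
Import numFieldNormedType.Exports.
Local Open Scope classical_set_scope.
Local Open Scope ring_scope.

Section LinearSpace.
Context {R : realType} {V : lmodType R}.
Implicit Types (A F H : set V) (a k u v y : V) (t : R).

Definition recession_cone A : set V :=
  [set u | [set x + t *: u | x in A & t in [set t : R | 0 <= t]] `<=` A].

(* algebraic interior, as opposed to the topological one *)
Definition core A : set V :=
  [set x | A x /\ forall v, exists2 e : R, 0 < e &
    forall t, 0 <= t <= e -> A (x + t *: v)].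

Definition contains_line H v : Prop :=
  exists x : V, range (fun t : R => x + t *: v) `<=` H.

Definition proper_set A : Prop := A !=set0 /\ A <> setT.

(* pairs (y, t) in F x R with y in a - H + t k *)
Definition feasible F a H k : set (V * R) :=
  [set p | F p.1 /\ [set a - h + p.2 *: k | h in H] p.1].

Definition optimal_solutions F a H k : set V :=
  [set y | F y /\ exists t, feasible F a H k (y, t) /\
    forall z s, feasible F a H k (z, s) -> t <= s].

End LinearSpace.

Definition nonneg_orthant (R : realType) (l : nat) : set 'rV[R]_l :=
  [set x | forall j : 'I_l, 0 <= x ord0 j].
Arguments nonneg_orthant : clear implicits.

(* Main.v *)
Require Import Defs.
From HB Require Import structures.
From mathcomp Require Import all_boot all_order all_algebra.
From mathcomp Require Import all_classical all_reals all_analysis.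
Import Order.TTheory GRing.Theory Num.Theory.
Import numFieldNormedType.Exports.
Local Open Scope classical_set_scope.
Local Open Scope ring_scope.

(** A pair [(y, t)] is feasible when [y] is in the level set
    [{y in F | a - y + t k in H}]. If a level set were unbounded in coordinate
    [j], then, since [F] is bounded below and [H] absorbs nonnegative vectors,
    [H] would contain a line in the direction [e^j]; so the level sets are
    compact. As [k] is in the core of [0^+H], any point of [H] can be moved into
    any other point by adding a large multiple of [k], which makes the problem
    feasible and, [H] being proper, bounds the feasible [t] from below. The
    feasible pairs with [t <= t0] thus form a compact set, on which [t] attains
    its minimum, and the optimal solutions form the level set of that minimum. *)

Lemma recession_coneP {R : realType} {V : lmodType R} (A : set V) (x u : V)
  (t : R) : recession_cone A u -> A x -> 0 <= t -> A (x + t *: u).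
Proof. by move=> Au Ax t0; apply: Au; exists x => //; exists t. Qed.

Lemma recession_cone_add {R : realType} {V : lmodType R} (A : set V) (x u : V) :
  recession_cone A u -> A x -> A (x + u).
Proof. by move=> Au Ax; rewrite -[u]scale1r; exact: recession_coneP. Qed.

(** For [s > 0], [v + s *: k = s *: (k + s^-1 *: v)]. Once [s^-1] is at most the core radius [e] in
    direction [v], this is a recession direction; so the threshold [e^-1] is uniform in [h]. *)
Lemma core_recession_absorb {R : realType} {V : lmodType R} (H : set V)
    (k v : V) : core (recession_cone H) k ->
  exists s0 : R, forall h s, H h -> s0 <= s -> H (h + v + s *: k).
Proof.
move=> [_ /(_ v)[e e0 He]]; exists e^-1 => h s Hh es.
have s0 : 0 < s by rewrite (lt_le_trans _ es)// invr_gt0.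
have -> : h + v + s *: k = h + s *: (k + s^-1 *: v).
  by rewrite scalerDr scalerA mulfV ?gt_eqF// scale1r addrAC addrA.
apply: recession_coneP => //; last exact: ltW.
by apply: He; rewrite invr_ge0 ltW//= -[leRHS]invrK lef_pV2 ?posrE ?invr_gt0.
Qed.

(** Were [t] too negative, adding [z - w] and the large multiple [- t] of [k] would carry
    [w + t *: k] to a point [z] outside [H]. *)
Lemma proper_core_lower_bound {R : realType} {V : lmodType R} (H : set V)
    (k w : V) : H <> setT -> core (recession_cone H) k ->
  exists m : R, forall t, H (w + t *: k) -> m <= t.
Proof.
move=> /eqP /setTPn[z nHz] kc.
have [s0 Hs] := core_recession_absorb H k (z - w) kc.
exists (- s0) => t Ht; rewrite leNgt; apply/negP => ts; apply: nHz.
have := Hs _ (- t) Ht; rewrite lerNr => /(_ (ltW ts)).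
suff -> : w + t *: k + (z - w) + - t *: k = z by [].
by rewrite scaleNr addrAC addrK addrC subrK.
Qed.

Lemma feasibleE {R : realType} {V : lmodType R} (F H : set V) (a k y : V)
  (t : R) : feasible F a H k (y, t) <-> F y /\ H (a - y + t *: k).
Proof.
split=> -[/= Fy]; last first.
  move=> Hy; split=> //=; exists (a - y + t *: k) => //.
  by rewrite opprD opprB addrA [a + _]addrC subrK subrK.
move=> [h Hh yE]; split=> //.
by rewrite -yE opprD opprB addrA [a + _]addrC subrK subrK.
Qed.

Lemma closed_feasible {R : realType} {V : normedModType R} (F H : set V)
  (a k : V) : closed F -> closed H -> closed (feasible F a H k).
Proof.
move=> Fcl Hcl.
have -> : feasible F a H k =
    fst @^-1` F `&` (fun p => a - p.1 + p.2 *: k) @^-1` H.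
  by apply/seteqP; split=> -[y t]; [move/feasibleE | move=> ?; exact/feasibleE].
apply: closedI; apply: preimage_closed => // p _; first exact: cvg_fst.
apply: cvgD; first by apply: cvgB; [exact: cvg_cst|exact: cvg_fst].
by apply: cvgZr_tmp; exact: cvg_snd.
Qed.

Lemma closed_level {R : realType} {V : normedModType R} (F H : set V)
  (a k : V) (t : R) : closed F -> closed H ->
  closed [set y | F y /\ H (a - y + t *: k)].
Proof.
move=> Fcl Hcl; apply: closedI => //.
apply: (@preimage_closed _ _ (fun y => a - y + t *: k)) => // y _.
apply: cvgD; last exact: cvg_cst.
by apply: cvgB; [exact: cvg_cst|exact: cvg_id].
Qed.

Section LevelSets.
Context {R : realType} {l : nat}.
Implicit Types (F H : set 'rV[R]_l) (a k u w y : 'rV[R]_l) (t : R).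

Lemma no_line_coordinate_bound H w (j : 'I_l) :
  nonneg_orthant R l `<=` recession_cone H ->
  ~ contains_line H (delta_mx ord0 j) ->
  exists s : R, forall x, nonneg_orthant R l x -> H (w - x) -> x ord0 j <= s.
Proof.
move=> Hrec nline.
have [s nHs] : exists s : R, ~ H (w + s *: delta_mx ord0 j).
  apply: contra_notP nline => /forallNP nex; exists w => _ [s _ <-].
  exact: contrapT.
(* If [x ord0 j > - s], then [x + s *: delta_mx ord0 j] is still nonnegative; adding it to [w - x]
   would put the excluded point in [H]. *)
exists (- s) => x x0 Hx; rewrite leNgt; apply/negP => sx; apply: nHs.
have -> : w + s *: delta_mx ord0 j = w - x + (x + s *: delta_mx ord0 j).
  by rewrite addrA subrK.
apply: recession_cone_add => //; apply: Hrec => i; rewrite !mxE eqxx /=.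
case: eqVneq => [->|_]; last by rewrite mulr0 addr0.
by rewrite mulr1 -[s]opprK subr_ge0 ltW.
Qed.

Lemma compact_level F H a k t :
  closed F -> (exists u, F `<=` [set u + x | x in nonneg_orthant R l]) ->
  closed H -> nonneg_orthant R l `<=` recession_cone H ->
  (forall j, ~ contains_line H (delta_mx ord0 j)) ->
  compact [set y | F y /\ H (a - y + t *: k)].
Proof.
move=> Fcl [u Fu] Hcl Hrec nline.
(* For [y = u + x], the point [a - y + t *: k] is [(a - u + t *: k) - x], so the bounds [s j] on [x]
   enclose the level set in a box. *)
have /choice[s Hs] j :=
  @no_line_coordinate_bound _ (a - u + t *: k) j Hrec (nline j).
have cB := rV_compact (fun j => @segment_compact R (u ord0 j) (u ord0 j + s j)).
apply: subclosed_compact cB _; first exact: closed_level.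
move=> _ [/Fu[x x0 <-]] Hx j /=; rewrite in_itv /= mxE lerDl x0 lerD2l /=.
by apply: Hs; [exact: x0|move: Hx; rewrite opprD addrA (addrAC (a - u))].
Qed.

End LevelSets.

Theorem proposition6 (R : realType) (l : nat) (hl : (1 <= l)%N)
  (a : 'rV[R]_l) (F : set 'rV[R]_l) (H : set 'rV[R]_l) (k : 'rV[R]_l)
  (F_nonempty : F !=set0) (F_closed : closed F)
  (F_bounded_below : exists u : 'rV[R]_l,
     F `<=` [set u + x | x in nonneg_orthant R l])
  (H_proper : proper_set H) (H_closed : closed H)
  (H_recession : nonneg_orthant R l `<=` recession_cone H)
  (k_recession : recession_cone H k) (k_neq0 : k <> 0)
  (k_core : core (recession_cone H) k)
  (H_no_line : forall j : 'I_l, ~ contains_line H (delta_mx ord0 j)) :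
  optimal_solutions F a H k !=set0 /\ compact (optimal_solutions F a H k).
Proof.
have Kc t := compact_level F H a k t F_closed F_bounded_below H_closed
  H_recession H_no_line.
case: H_proper => -[h Hh] HT; case: F_nonempty => y0 Fy0.
have [u Fu] := F_bounded_below.
have [t0 Ht0] : exists t, H (a - y0 + t *: k).
  have [s Hs] := core_recession_absorb H k (a - y0 - h) k_core.
  by exists s; have := Hs _ _ Hh (lexx s); rewrite [h + _]addrC subrK.
(* Basing the bound at [u] makes [m] independent of [y]: as [y - u] is nonnegative, [a - y + t *: k]
   in [H] forces [a - u + t *: k] in [H]. *)
have [m Hm] := proper_core_lower_bound H k (a - u) HT k_core.
pose S := feasible F a H k `&` [set p | p.2 <= t0].
have cS : compact S.
  apply: (@subclosed_compact _ _
    (* Level sets grow with [t], so the one at [t0] contains all those with [t <= t0]. *)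
    ([set y | F y /\ H (a - y + t0 *: k)] `*` `[m, t0])).
  - apply: closedI; first exact: closed_feasible.
    by apply: preimage_closed (@closed_le _ t0) => p _; exact: cvg_snd.
  - by apply: compact_setX => //; exact: segment_compact.
  - move=> [y t] [/feasibleE[Fy Hy] /= tt0]; split=> /=.
      split=> //; have -> : t0 = t + (t0 - t) by rewrite addrC subrK.
      by rewrite scalerDl addrA; apply: recession_coneP; rewrite ?subr_ge0.
    rewrite in_itv /= tt0 andbT; apply: Hm.
    have [x x0 xy] := Fu _ Fy.
    have -> : a - u + t *: k = a - y + t *: k + x.
      by rewrite -xy opprD addrA [RHS]addrAC subrK.
    by apply: recession_cone_add => //; exact: H_recession.
have S0 : S (y0, t0) by split=> /=; [exact/feasibleE|].
have snd_cont : {within S, continuous snd}.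
  by apply: continuous_subspaceT => p; exact: cvg_snd.
have [[y1 t1]] := compact_EVT_min (ex_intro _ _ S0) cS snd_cont.
rewrite inE => -[f1 /= t10] min1.
(* The minimum over [S] is global, since pairs outside [S] have [s > t0 >= t1]. *)
have min z s : feasible F a H k (z, s) -> t1 <= s.
  move=> fz; have [st|/ltW ts] := leP s t0; last exact: le_trans ts.
  by apply: (min1 (z, s)); rewrite inE.
have -> : optimal_solutions F a H k = [set y | F y /\ H (a - y + t1 *: k)].
  apply/seteqP; split=> y /=.
    move=> [Fy [t [ft mint]]].
    suff -> : t1 = t by exact/feasibleE.
    by apply/eqP; rewrite eq_le (min _ _ ft) (mint _ _ f1).
  by move=> Ky; split; [case: Ky|exists t1; split; [exact/feasibleE|]].
by split; [exists y1; exact/feasibleE|exact: Kc].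
Qed.
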